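(* In the setting described in the context, for every $\bm{x}\in\mathcal{X}_t(\{\bm{x}_0\})$ there exists $(\bm{\sigma},\lambda)\in\mathcal{W}_t\times[0,1]$ such that $$\bm{x}=\bm{\pi}(\bm{\sigma},\lambda):=\lambda\,\bm{x}^{\rm upper}(\bm{\sigma})+(1-\lambda)\,\bm{x}^{\rm lower}(\bm{\sigma});$$ i.e., the map $\bm{\pi}:\mathcal{W}_t\times[0,1]\to\mathcal{X}_t(\{\bm{x}_0\})$ is surjective.
   Context: Let $\bm{A}\in\mathbb{R}^{n\times n}$, $\bm{b}\in\mathbb{R}^n$ with $(\bm{A},\bm{b})$ controllable and $\bm{A}$ having $n$ distinct eigenvalues; let $v_{\min}\le v_{\max}$ be constants, $\bm{z}_0\in\mathbb{R}^n$, $t>0$, and $\bm{x}_0:=\bm{M}\bm{z}_0$. Here $\bm{C}=(\bm{b},\bm{A}\bm{b},\dots,\bm{A}^{n-1}\bm{b})$, $\bm{q}^\top$ is the last row of $\bm{C}^{-1}$, $\bm{M}$ has rows $\bm{q}^\top,\bm{q}^\top\bm{A},\dots,\bm{q}^\top\bm{A}^{n-1}$; $\bm{c}=(c_0,\dots,c_{n-1})^\top$ are the coefficients of the characteristic polynomial $\lambda^n+c_{n-1}\lambda^{n-1}+\dots+c_0$ of $\bm{A}$; $\bm{A}_{\rm con}=\bm{M}\bm{A}\bm{M}^{-1}$ is the companion matrix with first $n-1$ rows $(\bm{0}\ \bm{I}_{n-1})$ and last row $-\bm{c}^\top$; $\bm{b}_{\rm con}=(0,\dots,0,1)^\top$;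 $\bm{A}_{\rm int}$ has first $n-1$ rows $(\bm{0}\ \bm{I}_{n-1})$ and last row zero. For $0\le s\le t$, with $f(\tau)=\langle\bm{c},e^{(s-\tau)\bm{A}_{\rm con}}\bm{b}_{\rm con}\rangle$ and $I(v)=v(s)-\int_0^s f(\tau)v(\tau)\,{\rm d}\tau$, let $I_{\min}(s),I_{\max}(s)$ be the inf and sup of $I(v)$ over $v\in C([0,s])$ with $v_{\min}\le v\le v_{\max}$, and $u_{\min}(s)=-\langle\bm{c},e^{s\bm{A}_{\rm con}}\bm{M}\bm{z}_0\rangle+I_{\min}(s)$, $u_{\max}(s)=-\langle\bm{c},e^{s\bm{A}_{\rm con}}\bm{M}\bm{z}_0\rangle+I_{\max}(s)$. The integrator reach set $\mathcal{X}_t(\{\bm{x}_0\})$ is the set of $\bm{x}(t)$ with $\dot{\bm{x}}=\bm{A}_{\rm int}\bm{x}+\bm{b}_{\rm con}u$, $\bm{x}(0)=\bm{x}_0$, $u\in C([0,t])$, $u_{\min}(s)\le u(s)\le u_{\max}(s)$ for all $s$. Define $\mu=(u_{\max}-u_{\min})/2$, $\nu=(u_{\max}+u_{\min})/2$, $\bm{\xi}(s)=\big(\tfrac{s^{n-1}}{(n-1)!},\dots,s,1\big)^\top$, $\chi_k(t,\bm{x}_0)=\sum_{\ell=k}^{n}\frac{t^{\ell-k}}{(\ell-k)!}x_{\ell0}$, $\mathcal{W}_t:=\{\bm{\sigma}\in\mathbb{R}^{n-1}\mid 0\le\sigma_1\le\dots\le\sigma_{n-1}\le t\}$, and, with $\sigma_0:=0,\sigma_n:=t$,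 $\bm{x}^{\rm upper/lower}(\bm{\sigma})=\bm{\chi}(t,\bm{x}_0)+\int_0^t\nu(s)\bm{\xi}(t-s)\,{\rm d}s\pm\sum_{i=1}^{n}(-1)^{i-1}\int_{\sigma_{i-1}}^{\sigma_i}\mu(s)\bm{\xi}(t-s)\,{\rm d}s$ (plus sign for upper, minus for lower); these are the points of the two bounding surfaces of $\mathcal{X}_t(\{\bm{x}_0\})$. *)

(* Defs.v *)
From HB Require Import structures.
From mathcomp Require Import all_boot all_order all_algebra.
From mathcomp Require Import all_classical all_reals all_analysis.
From mathcomp Require Import complex.
Set Implicit Arguments.
Unset Strict Implicit.
Unset Printing Implicit Defensive.
Import Order.TTheory GRing.Theory Num.Theory.
Import numFieldNormedType.Exports.
Local Open Scope classical_set_scope.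
Local Open Scope ring_scope.

(* Convention: the state dimension of the paper, n, is written  m.+1  here
   (so n >= 1).  Indices are 0-based: paper's index k (1..n) is k-1 here. *)

Section Setting.
Variable R : realType.
Variable m : nat.
Local Notation N := m.+1.

Definition mexp (X : 'M[R]_N) : 'M[R]_N :=
  \matrix_(i, j) limn (fun K : nat => (\sum_(k < K) (X ^+ k) i j / (k`!)%:R)).

(* real interval integral  \int_a^b g  (used with a <= b) *)
Definition integ (a b : R) (g : R -> R) : R :=
  \int[lebesgue_measure]_(s in `[a, b]) g s.

Variables (A : 'M[R]_N) (b : 'cV[R]_N).

Definition ctrb : 'M[R]_N := \matrix_(i, j) (A ^+ j *m b) i 0.
Definition controllable : Prop := ctrb \in unitmx.

Definition distinct_eigenvalues : Prop :=
  exists s : seq R[i], [/\ size s = N, uniq s &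
    all (eigenvalue (map_mx (real_complex R) A)) s].

Definition qT : 'rV[R]_N := row ord_max (invmx ctrb).
Definition Mmat : 'M[R]_N := \matrix_(i, j) (qT *m A ^+ i) 0 j.
Definition cvec : 'cV[R]_N := \col_i (char_poly A)`_i.
Definition Acon : 'M[R]_N :=
  \matrix_(i, j) if (i < m)%N then ((j : nat) == i.+1)%:R else - cvec j 0.
Definition bcon : 'cV[R]_N := \col_i ((i : nat) == m)%:R.
Definition Aint : 'M[R]_N :=
  \matrix_(i, j) if (i < m)%N then ((j : nat) == i.+1)%:R else 0.

Definition dotc (x y : 'cV[R]_N) : R := \sum_i x i 0 * y i 0.

Variables (vmin vmax : R) (z0 : 'cV[R]_N) (t : R).

Definition x0 : 'cV[R]_N := Mmat *m z0.

Definition ffun (s tau : R) : R := dotc cvec (mexp ((s - tau) *: Acon) *m bcon).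
Definition Ifun (s : R) (v : R -> R) : R :=
  v s - integ 0 s (fun tau => ffun s tau * v tau).
Definition adm (s : R) (v : R -> R) : Prop :=
  {within `[0, s], continuous v} /\
  (forall tau, 0 <= tau <= s -> vmin <= v tau <= vmax).
Definition Imin (s : R) : R := inf [set Ifun s v | v in adm s].
Definition Imax (s : R) : R := sup [set Ifun s v | v in adm s].
Definition umin (s : R) : R := - dotc cvec (mexp (s *: Acon) *m x0) + Imin s.
Definition umax (s : R) : R := - dotc cvec (mexp (s *: Acon) *m x0) + Imax s.

Definition reach_set : set 'cV[R]_N :=
  [set x1 | exists u : R -> R,
     [/\ {within `[0, t], continuous u},
         (forall s, 0 <= s <= t -> umin s <= u s <= umax s) &
         exists x : R -> 'cV[R]_N,
           [/\ x 0 = x0, x t = x1,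
               (forall i, {within `[0, t], continuous (fun r => x r i 0)}) &
               (forall s, 0 < s < t -> forall i,
                   is_derive s 1 (fun r => x r i 0)
                     ((Aint *m x s) i 0 + bcon i 0 * u s))]]].

Definition mu (s : R) : R := (umax s - umin s) / 2.
Definition nu (s : R) : R := (umax s + umin s) / 2.
Definition xi (s : R) : 'cV[R]_N := \col_i (s ^+ (m - i) / ((m - i)`!)%:R).
Definition chi : 'cV[R]_N :=
  \col_i (\sum_(j < N | (i <= j)%N) t ^+ (j - i) / ((j - i)`!)%:R * x0 j 0).

(* sigma = (sigma_1,...,sigma_{n-1}); extended with sigma_0 = 0, sigma_n = t *)
Definition sig_ext (sigma : 'I_m -> R) (k : nat) : R :=
  if k == 0%N then 0 else nth t [seq sigma i | i <- enum 'I_m] k.-1.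
Definition W_t (sigma : 'I_m -> R) : Prop :=
  forall k : nat, (k < N)%N -> sig_ext sigma k <= sig_ext sigma k.+1.

Definition x_mid : 'cV[R]_N :=
  \col_i (chi i 0 + integ 0 t (fun s => nu s * xi (t - s) i 0)).
Definition x_alt (sigma : 'I_m -> R) : 'cV[R]_N :=
  \col_i (\sum_(k < N) (-1) ^+ k *
            integ (sig_ext sigma k) (sig_ext sigma k.+1)
                  (fun s => mu s * xi (t - s) i 0)).
Definition x_upper (sigma : 'I_m -> R) : 'cV[R]_N := x_mid + x_alt sigma.
Definition x_lower (sigma : 'I_m -> R) : 'cV[R]_N := x_mid - x_alt sigma.
Definition pi_map (sigma : 'I_m -> R) (lam : R) : 'cV[R]_N :=
  lam *: x_upper sigma + (1 - lam) *: x_lower sigma.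

End Setting.

(* Main.v *)
(* Write [w = u - nu], so that [|w| <= mu]. Since the [i]-th coordinate of
   [xi (t - s)] is a polynomial in [s] of degree at most [n - 1], the theorem says
   that the moments of [w] against such polynomials are those of [K] times a
   bang-bang function [+- mu] with at most [n - 1] switches, [0 <= K <= 1].
   To find it, maximise [y p / F p] over nonzero polynomials of degree at most
   [n - 1], where [y p] is the integral of [w p] and [F p] that of [mu |p|]. If [p]
   is a maximiser and [K] the maximum, then [K F - y >= 0] vanishes at [p], so its
   directional derivatives there vanish: [y q] is [K] times the integral of
   [sgn(p) mu q] for every [q]. The switching times are the roots of [p] in
   [(0, t)] counted with multiplicity, padded with [t].
   The bounds [umin] and [umax] are continuous because reflecting time turns
   [I_max s] into a supremum over a set of inputs that does not depend on [s], of
   functionals that are Lipschitz in [s]. *)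
Require Import Defs.
From HB Require Import structures.
From mathcomp Require Import all_boot all_order all_algebra.
From mathcomp Require Import all_classical all_reals all_analysis.
From mathcomp Require Import complex.
From mathcomp Require Import ring lra zify.
Import Order.TTheory GRing.Theory Num.Theory.
Import numFieldNormedType.Exports.
Set Implicit Arguments.
Unset Strict Implicit.
Unset Printing Implicit Defensive.
Local Open Scope classical_set_scope.
Local Open Scope ring_scope.

Lemma cvg_sum_real {R : realType} {T I : Type} (F : set_system T) {FF : Filter F}
    (r : seq I) (P : pred I) (f : I -> T -> R) (l : I -> R) :
  (forall i, P i -> f i @ F --> l i) ->
  (fun x => \sum_(i <- r | P i) f i x) @ F --> \sum_(i <- r | P i) l i.
Proof.
move=> fl; apply: cvg_big => //.
by move=> [x y]; apply: cvgD; [exact: cvg_fst|exact: cvg_snd].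
Qed.

(** * Integrals of continuous functions over compact intervals *)

Section IntervalIntegral.
Context {R : realType}.
Implicit Types (f g : R -> R) (a b c : R).
Local Notation mu := (@lebesgue_measure R).

Lemma continuous_integrable f a b :
  continuous f -> mu.-integrable `[a, b] (EFin \o f).
Proof.
move=> cf; apply: continuous_compact_integrable; first exact: segment_compact.
exact: continuous_subspaceT.
Qed.

Lemma eq_integ f g a b :
  (forall s, a <= s <= b -> f s = g s) -> integ a b f = integ a b g.
Proof.
by move=> fg; apply: eq_Rintegral => s; rewrite inE/= in_itv/=; exact: fg.
Qed.

Lemma integD f g a b : continuous f -> continuous g ->
  integ a b (fun s => f s + g s) = integ a b f + integ a b g.
Proof. by move=> cf cg; apply: RintegralD => //; exact: continuous_integrable. Qed.

Lemma integB f g a b : continuous f -> continuous g ->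
  integ a b (fun s => f s - g s) = integ a b f - integ a b g.
Proof. by move=> cf cg; apply: RintegralB => //; exact: continuous_integrable. Qed.

Lemma integZ k f a b : continuous f ->
  integ a b (fun s => k * f s) = k * integ a b f.
Proof. by move=> cf; apply: RintegralZl => //; exact: continuous_integrable. Qed.

Lemma integ_cst k a b : a <= b -> integ a b (fun=> k) = k * (b - a).
Proof.
move=> ab; rewrite /integ Rintegral_cst//.
have E : mu `[a, b] = if (a < b)%R then (b%:E - a%:E)%E else 0%E.
  by rewrite lebesgue_measure_itv/= lte_fin.
rewrite [X in k * fine X]E.
by case: ltgtP ab => //= -> _; rewrite subrr.
Qed.

Lemma le_integ f g a b : continuous f -> continuous g ->
  (forall s, a <= s <= b -> f s <= g s) -> integ a b f <= integ a b g.
Proof.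
move=> cf cg fg; apply: le_Rintegral => //; try exact: continuous_integrable.
Qed.

Lemma integ_ge0 f a b : (forall s, a <= s <= b -> 0 <= f s) -> 0 <= integ a b f.
Proof. by move=> f0; apply: Rintegral_ge0 => s /=; rewrite in_itv/=; exact: f0. Qed.

Lemma normr_integ f a b : continuous f ->
  `|integ a b f| <= integ a b (fun s => `|f s|).
Proof. by move=> cf; apply: le_normr_Rintegral => //; exact: continuous_integrable. Qed.

Lemma integ_split f a b c : a <= b -> b <= c -> continuous f ->
  integ a c f = integ a b f + integ b c f.
Proof.
move=> ab bc cf; apply/eqP; rewrite addrC -subr_eq; apply/eqP.
rewrite /integ Rintegral_itvB//; last exact: continuous_integrable.
rewrite -[RHS]Rintegral_itv_obnd_cbnd//.
apply: (integrableS _ _ _ (@continuous_integrable f b c cf)) => //.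
exact: subset_itv_oc_cc.
Qed.

Lemma integ1 f a : integ a a f = 0.
Proof. by rewrite /integ set_itv1 Rintegral_set1. Qed.

(** Near [x] the function exceeds [f x / 2], so a short interval around [x] inside [[a, b]] already
    contributes a positive amount. *)
Lemma integ_gt0 f a b x : continuous f -> (forall s, a <= s <= b -> 0 <= f s) ->
  a < x < b -> 0 < f x -> 0 < integ a b f.
Proof.
move=> cf f0 /andP[ax xb] fx.
have : \forall y \near x, f x / 2 < f y.
  by apply: (cvgr_gt (f x) (cf x)); lra.
move=> /nbhs_ballP[e /= e0 He].
pose d := Num.min (e / 2) (Num.min (x - a) (b - x)).
have d0 : 0 < d by rewrite !lt_min; lra.
have [d1 d2 d3] : [/\ d <= e / 2, d <= x - a & d <= b - x].
  by rewrite /d; split; rewrite !ge_min ?lexx ?orbT.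
rewrite (@integ_split f a (x - d) b)//; [|lra|lra].
rewrite (@integ_split f (x - d) (x + d) b)//; [|lra|lra].
have h1 : 0 <= integ a (x - d) f by apply: integ_ge0 => s hs; apply: f0; lra.
have h2 : 0 <= integ (x + d) b f by apply: integ_ge0 => s hs; apply: f0; lra.
have h3 : f x / 2 * (x + d - (x - d)) <= integ (x - d) (x + d) f.
  rewrite -(@integ_cst (f x / 2)); last lra.
  apply: le_integ => //; first exact: cst_continuous.
  move=> s hs; apply/ltW/He; rewrite /ball/= ltr_norml; lra.
have : 0 < f x / 2 * (x + d - (x - d)) by apply: mulr_gt0; lra.
lra.
Qed.

(** Substitution along the decreasing map [s - x], of derivative -1. This is what allows inputs to
    be read backwards in time. *)
Lemma integ_reflect g s : 0 <= s -> continuous g ->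
  integ 0 s (fun r => g (s - r)) = integ 0 s g.
Proof.
move=> s0 cg; rewrite /integ /Rintegral; congr fine; apply/esym.
have dF : derive1 (fun x : R => s - x) = cst (-1).
  by apply/funext => x; rewrite derive1E deriveB// derive_cst derive_id sub0r.
have cF : continuous (fun x : R => s - x).
  by move=> x; apply: cvgB; [exact: cvg_cst|exact: cvg_id].
have := @integration_by_substitution_decreasing R (fun x => s - x) g 0 s s0.
rewrite subr0 subrr => -> //.
- by apply: eq_integral => x _; rewrite dF !fctE opprK mulr1.
- by move=> x y _ _ xy; rewrite ltrD2l ltrN2.
- by rewrite dF => x _; exact: cvg_cst.
- by rewrite dF; exact: is_cvg_cst.
- by rewrite dF; exact: is_cvg_cst.
- split=> [x _||]; first exact: derivableB.
    by apply: cvg_at_right_filter; exact: cF.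
  by apply: cvg_at_left_filter; exact: cF.
- exact: continuous_subspaceT.
Qed.

End IntervalIntegral.

(** * Roots and sign changes of a polynomial on an open interval *)

Section SignPattern.
Context {R : realType}.
Implicit Types (p h : {poly R}).

(** Linear factors are split off as long as a root remains in the interval; each one lowers the size
    by one, so [r] lists the roots with multiplicity. *)
Lemma poly_factor_itv (t : R) p : p != 0 ->
  exists (r : seq R) h, [/\ p = h * \prod_(x <- r) ('X - x%:P),
    (size r < size p)%N, all (fun x => 0 < x < t) r &
    forall x, 0 < x < t -> h.[x] != 0].
Proof.
have [n] := ubnP (size p); elim: n p => // n ih p; rewrite ltnS => sp p0.
have [[x x0t /eqP px]|nr] := pselect (exists2 x, 0 < x < t & p.[x] = 0); last first.
  exists [::], p; split => //; first by rewrite big_nil mulr1.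
    by rewrite size_poly_gt0.
  by move=> x hx; apply/eqP => px; apply: nr; exists x.
have /factor_theorem[q pE] := px.
have q0 : q != 0 by apply: contraNneq p0 => q0; rewrite pE q0 mul0r.
have sq : size p = (size q).+1.
  by rewrite pE size_Mmonic ?monicXsubC// size_XsubC addn2.
have [r [h [qE sr ar hr]]] := ih q (leq_trans (eq_leq (esym sq)) sp) q0.
exists (x :: r), h; split => //=.
- by rewrite pE qE big_cons -mulrA; congr (_ * _); rewrite mulrC.
- by rewrite sq ltnS.
- by rewrite x0t.
Qed.

(** The sign is read off at the midpoint [y]; by the intermediate value theorem, a point of another
    sign would force a root between it and [y]. *)
Lemma horner_constant_sign (t : R) h : (forall x, 0 < x < t -> h.[x] != 0) ->
  exists e : bool, forall x, 0 < x < t -> 0 < (-1) ^+ e * h.[x].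
Proof.
move=> hn.
have [t0|t0] := ltP 0 t; last by exists false => x hx; lra.
pose y := t / 2.
have hy : 0 < y < t by rewrite /y; lra.
exists (h.[y] < 0) => x hx; rewrite ltNge; apply/negP => hle.
have cfx a b : {within `[a, b], continuous (horner h)}.
  by apply: continuous_subspaceT; exact: continuous_horner.
have [c hc hc0] : exists2 c, 0 < c < t & h.[c] = 0.
  have hhy : h.[y] != 0 := hn _ hy.
  have main a b : a <= b -> 0 < a -> b < t ->
      (h.[a] <= 0 <= h.[b]) || (h.[b] <= 0 <= h.[a]) ->
      exists2 c, 0 < c < t & h.[c] = 0.
    move=> ab a0 bt H.
    have [c] := IVT ab (cfx a b) (v := 0) ltac:(by rewrite ge_min le_max; case/orP: H => /andP[-> ->]; rewrite ?orbT).
    rewrite in_itv/= => hc h0; exists c => //; lra.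
  have Hxy : (h.[x] <= 0 <= h.[y]) || (h.[y] <= 0 <= h.[x]).
    case: (ltgtP h.[y] 0) hle hhy => hy0; rewrite ?eqxx//= => hle _.
      by apply/orP; right; lra.
    by apply/orP; left; lra.
  have [xy|/ltW yx] := leP x y.
    by apply: (main x y) => //; lra.
  by apply: (main y x) => //; rewrite 1?orbC//; lra.
by move: (hn c hc); rewrite hc0 eqxx.
Qed.

(* Unused slots of the pattern are filled by [nth]'s default [t], so that the
   switching times beyond the last root coincide with the end point. *)
Lemma poly_sign_pattern (t : R) p : 0 < t -> p != 0 ->
  exists (r : seq R) (e : bool), [/\ (size r < size p)%N,
    sorted <=%R (0 :: r), all (fun x => x <= t) r &
    forall k s, (k <= size r)%N -> nth t (0 :: r) k < s < nth t r k ->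
      0 < (-1) ^+ e * (-1) ^+ k * p.[s]].
Proof.
move=> t0 p0.
have [r0 [h [pE sr ar hn]]] := poly_factor_itv t p0.
have [e he] := horner_constant_sign hn.
pose r := sort <=%R r0.
have ar' : all (fun x => 0 < x < t) r by rewrite all_sort.
have pE' : p = h * \prod_(x <- r) ('X - x%:P).
  by rewrite pE; congr (_ * _); apply/esym/perm_big; rewrite perm_sort.
have sor : sorted <=%R r by apply: sort_sorted; exact: le_total.
have sr' : size r = size r0 by rewrite size_sort.
(* Before the first root all [size r] linear factors are negative, hence the correction of the sign
   of [h] by [odd (size r)]. *)
exists r, (e (+) odd (size r)); split.
- by rewrite sr'.
- rewrite /= path_min_sorted//; apply: sub_all ar' => x /andP[/ltW]//.
- by apply: sub_all ar' => x /andP[_ /ltW].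
move=> k s kr /andP[ks sk].
have s0t : 0 < s < t.
  apply/andP; split.
    apply: le_lt_trans ks; case: k kr {sk} => [|k] //= kr.
    by have /andP[/ltW] := allP ar' _ (mem_nth t kr).
  apply: lt_le_trans sk _.
  have [kr'|?] := ltnP k (size r); last by rewrite nth_default.
  by have /andP[_ /ltW] := allP ar' _ (mem_nth t kr').
have lek i j : (i <= j)%N -> (j < size r)%N -> nth t r i <= nth t r j.
  move=> ij jr; apply: (sorted_leq_nth le_trans le_refl) => //.
  by rewrite inE (leq_ltn_trans ij).
(* The first [k] roots lie below [s] and the other [size r - k] above it, which gives the number of
   negative factors. *)
have Hprod : 0 < (-1) ^+ (size r - k) * \prod_(x <- r) (s - x).
  rewrite -[X in \prod_(x <- X) _](cat_take_drop k) big_cat/= mulrCA.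
  apply: mulr_gt0.
    rewrite big_seq; apply: prodr_gt0 => x xin; case: (elimT (nthP t) xin) => i.
    rewrite size_takel// => ik <-; rewrite nth_take// subr_gt0.
    apply: le_lt_trans ks; case: k ik kr {sk xin} => // k ik kr /=.
    exact: lek.
  have : all (fun x => s < x) (drop k r).
    apply/(all_nthP t) => i; rewrite size_drop => ik.
    rewrite nth_drop; apply: lt_le_trans sk _; apply: lek.
      exact: leq_addr.
    by rewrite -ltn_subRL.
  rewrite -size_drop; elim: (drop k r) => [|x l ihl] /=.
    by rewrite big_nil expr0 mulr1.
  move=> /andP[sx /ihl hl]; rewrite big_cons exprS.
  have -> : -1 * (-1) ^+ size l * ((s - x) * \prod_(j <- l) (s - j)) =
    (x - s) * ((-1) ^+ size l * \prod_(j <- l) (s - j)) by ring.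
  by apply: mulr_gt0 => //; rewrite subr_gt0.
have -> : (-1) ^+ (e (+) odd (size r)) * (-1) ^+ k * p.[s] =
   ((-1) ^+ e * h.[s]) * ((-1) ^+ (size r - k) * \prod_(x <- r) (s - x)).
  rewrite pE' hornerM horner_prod.
  under eq_bigr do rewrite hornerXsubC.
  rewrite signr_addb signr_odd -{1}(subnK kr) exprD.
  have := sqrr_sign R k; rewrite expr2 => E.
  have -> : (-1) ^+ e * ((-1) ^+ (size r - k) * (-1) ^+ k) * (-1) ^+ k =
    (-1) ^+ e * (-1) ^+ (size r - k) * ((-1) ^+ k * (-1) ^+ k) :> R by ring.
  by rewrite E; ring.
by apply: mulr_gt0 => //; exact: he.
Qed.

End SignPattern.

(** * Directional derivative of a weighted integral of an absolute value *)

Section AbsDerivative.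
Context {R : realType}.
Implicit Types (P Q M f : R -> R) (a b : R).
Local Notation mu := (@lebesgue_measure R).

(** The sign of [P] is known only in the interior of each piece, so limits are taken over the open
    interval. *)
Lemma integ_oo f a b : continuous f ->
  integ a b f = \int[mu]_(s in `]a, b[) f s.
Proof.
move=> cf; have ic := @continuous_integrable _ f a b cf.
rewrite -[RHS]/(Rintegral _ _ _) Rintegral_itv_bndo_bndc; last first.
  by apply: (integrableS _ _ _ ic) => //; exact: subset_itv_oo_cc.
rewrite Rintegral_itv_obnd_cbnd//.
by apply: (integrableS _ _ _ ic) => //; exact: subset_itv_oc_cc.
Qed.

(* Dominated convergence: the difference quotients of [|P + e Q|] are bounded
   by [|Q|] and eventually constant wherever [P] does not vanish. *)
Lemma cvg_diff_quotient_integ_abs P Q M (e : bool) a b :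
  continuous P -> continuous Q -> continuous M ->
  (forall s, a < s < b -> 0 < (-1) ^+ e * P s) ->
  (fun n : nat => n.+1%:R * (integ a b (fun s => `|P s + n.+1%:R^-1 * Q s| * M s)
     - integ a b (fun s => `|P s| * M s))) @ \oo -->
  (-1) ^+ e * integ a b (fun s => Q s * M s).
Proof.
move=> cP cQ cM Pe.
have cQM : continuous (fun s => Q s * M s) by move=> s; apply: cvgM; [exact: cQ|exact: cM].
have cPM : continuous (fun s => `|P s| * M s).
  by move=> s; apply: cvgM; [apply: cvg_norm; exact: cP|exact: cM].
have cPQ n : continuous (fun s => `|P s + n.+1%:R^-1 * Q s| * M s).
  move=> s; apply: cvgM; last exact: cM.
  by apply: cvg_norm; apply: cvgD; [exact: cP|apply: cvgM; [exact: cvg_cst|exact: cQ]].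
pose f_ n s := n.+1%:R * (`|P s + n.+1%:R^-1 * Q s| * M s - `|P s| * M s).
pose f s := (-1) ^+ e * (Q s * M s).
have cf_ n : continuous (f_ n).
  move=> s; apply: cvgM; first exact: cvg_cst.
  by apply: cvgB; [exact: cPQ|exact: cPM].
have cf : continuous f by move=> s; apply: cvgM; [exact: cvg_cst|exact: cQM].
have E n : n.+1%:R * (integ a b (fun s => `|P s + n.+1%:R^-1 * Q s| * M s)
     - integ a b (fun s => `|P s| * M s)) = \int[mu]_(s in `]a, b[) f_ n s.
  rewrite -integ_oo// /f_ integZ ?integB//.
  by move=> s; apply: cvgB; [exact: cPQ|exact: cPM].
rewrite (_ : (fun n : nat => _) = fun n => \int[mu]_(s in `]a, b[) f_ n s); last first.
  by apply/funext => n; exact: E.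
rewrite -integZ// (integ_oo _ _ cf).
have iS (g : R -> R) : continuous g -> mu.-integrable `]a, b[ (EFin \o g).
  move=> cg; apply: (integrableS _ _ _ (@continuous_integrable _ g a b cg)) => //.
  exact: subset_itv_oo_cc.
have [] := @dominated_convergence _ _ R mu _ (measurable_itv `]a, b[)
  (fun n => EFin \o f_ n) (EFin \o f) (EFin \o (fun s => `|Q s * M s|)).
- by move=> n; have /integrableP[] := iS _ (cf_ n).
- by have /integrableP[] := iS _ cf.
- apply: aeW => s /=; rewrite in_itv/= => sab.
  apply/cvg_EFin; first by apply: nearW.
  have P0 := Pe s sab.
  have nP0 : 0 < `|P s| by rewrite normr_gt0; apply: contraTneq P0 => ->; rewrite mulr0 ltxx.
  apply: cvg_near_cst.
  near=> n; rewrite /f_ /f /=.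
  (* For such [n] the perturbation is smaller than [|P s|], so the perturbed value keeps the sign of
     [P s] and both absolute values open the same way. *)
  have hn : `|Q s| < n.+1%:R * `|P s|.
    rewrite -ltr_pdivrMr//; apply: lt_trans (_ : n%:R < _); last by rewrite ltr_nat.
    near: n; exact: nbhs_infty_gtr.
  have n0 : 0 < n.+1%:R :> R by rewrite ltr0n.
  have hq : `|n.+1%:R^-1 * Q s| < `|P s|.
    by rewrite normrM ger0_norm ?invr_ge0 ?ltW// ltr_pdivrMl.
  rewrite -mulrBl [LHS]mulrA [RHS]mulrA; congr (_ * _).
  have Qx : Q s = n.+1%:R * (n.+1%:R^-1 * Q s) by rewrite mulrA divff ?mul1r// gt_eqF.
  set x := n.+1%:R^-1 * Q s in hq Qx *; rewrite Qx.
  rewrite mulrCA; congr (_ * _).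
  move: P0; case: (e); rewrite /= ?expr1 ?expr0 ?mulN1r ?mul1r ?oppr_gt0 => P0.
    move: hq; rewrite (ltr0_norm P0) ltr_norml => hq.
    by rewrite ler0_norm; lra.
  move: hq; rewrite (gtr0_norm P0) ltr_norml => hq.
  by rewrite ger0_norm; lra.
- by apply: iS => s; apply: cvg_norm; exact: cQM.
- apply: aeW => s n _ /=; rewrite lee_fin /f_ -mulrBl !normrM mulrA.
  apply: ler_wpM2r => //.
  rewrite ger0_norm// -ler_pdivlMl ?ltr0n//.
  apply: le_trans (ler_dist_dist _ _) _.
  by rewrite addrAC subrr add0r normrM ger0_norm ?invr_ge0.
move=> intf _ cv.
have : [sequence (\int[mu]_(x in `]a, b[) (EFin \o f_ n) x)%E]_n @ \oo -->
  (\int[mu]_(x in `]a, b[) f x)%:E.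
  rewrite /Rintegral fineK//; exact: integrable_fin_num.
by move=> /fine_cvg.
Unshelve. all: by end_near.
Qed.

End AbsDerivative.

(** * Moments of a dominated function against polynomials *)

Section Moments.
Context {R : realType}.

Lemma lipschitz_continuous (V : normedModType R) (f : V -> R) (C : R) :
  (forall a b, `|f a - f b| <= C * `|a - b|) -> continuous f.
Proof.
move=> fL a; apply/cvgrPdist_lt => e e0.
(* [C] may be zero or negative; this positive constant can be divided by. *)
have C0 : 0 < `|C| + 1 by rewrite ltr_wpDl.
near=> b.
apply: le_lt_trans (fL a b) _.
apply: le_lt_trans (_ : (`|C| + 1) * `|a - b| < _).
  by rewrite ler_wpM2r//; apply: le_trans (ler_norm C) _; rewrite lerDl.
rewrite -ltr_pdivlMl//; near: b.
have := @cvg_id _ (nbhs a); move=> /cvgrPdist_lt; apply.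
by rewrite mulr_gt0 ?invr_gt0.
Unshelve. all: by end_near. Qed.

Lemma integ_chain (sg : nat -> R) (f : R -> R) n :
  (forall k, sg k <= sg k.+1) -> continuous f ->
  integ (sg 0%N) (sg n) f = \sum_(k < n) integ (sg k) (sg k.+1) f.
Proof.
move=> sgS cf; elim: n => [|n ih]; first by rewrite big_ord0 integ1.
rewrite big_ord_recr/= -ih; apply: integ_split => //.
by elim: n {ih} => // n ih; exact: le_trans ih (sgS n).
Qed.

(** [nth t r k] is the entry of index [k.+1] of [0 :: r], so this orders consecutive switching
    times; at the end of the list the default [t], which bounds every entry, takes over. *)
Lemma nth_switch_le (t : R) (r : seq R) k : 0 <= t ->
  sorted <=%R (0 :: r) -> all (fun x => x <= t) r ->
  nth t (0 :: r) k <= nth t r k.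
Proof.
move=> t0; rewrite /=; elim: r 0 t0 k => [|x r ih] y yt k /=.
  by move=> _ _; case: k => [|k] //=; rewrite ?nth_nil.
move=> /andP[yx xr] /andP[xt rt]; case: k => [|k] //=.
exact: ih.
Qed.

Context (t : R) (m : nat) (W M : R -> R) (t0 : 0 < t)
  (cW : continuous W) (cM : continuous M)
  (WM : forall s, 0 <= s <= t -> `|W s| <= M s) (M0 : 0 < M 0).

(** [F] turns out to be a weighted L1 norm on polynomials, and [y] a linear functional bounded by
    it. *)
Let F (p : {poly R}) := integ 0 t (fun s => `|p.[s]| * M s).
Let y (p : {poly R}) := integ 0 t (fun s => p.[s] * W s).

Let M_ge0 s : 0 <= s <= t -> 0 <= M s.
Proof. by move=> /WM; apply: le_trans. Qed.

Let cpM (p : {poly R}) : continuous (fun s : R => `|p.[s]| * M s).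
Proof.
by move=> s; apply: cvgM; [apply: cvg_norm; exact: continuous_horner|exact: cM].
Qed.

Let cpW (p : {poly R}) : continuous (fun s : R => p.[s] * W s).
Proof. by move=> s; apply: cvgM; [exact: continuous_horner|exact: cW]. Qed.

Let yD p q : y (p + q) = y p + y q.
Proof.
rewrite /y -integD//; apply: eq_integ => s _; rewrite hornerD; ring.
Qed.

Let yZ k p : y (k *: p) = k * y p.
Proof. rewrite /y -integZ//; apply: eq_integ => s _; rewrite hornerZ; ring. Qed.

Let FZ k p : F (k *: p) = `|k| * F p.
Proof.
by rewrite /F -integZ//; apply: eq_integ => s _; rewrite hornerZ normrM mulrA.
Qed.

Let FD p q : F (p + q) <= F p + F q.
Proof.
rewrite /F -integD//; apply: le_integ => //.
  by move=> s; apply: cvgD; exact: cpM.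
move=> s st; rewrite -mulrDl hornerD ler_wpM2r ?M_ge0//.
exact: ler_normD.
Qed.

Let normy p : `|y p| <= F p.
Proof.
apply: (le_trans (normr_integ 0 t (@cpW p))); apply: le_integ => //.
  by move=> s; apply: cvg_norm; exact: cpW.
by move=> s st; rewrite normrM ler_wpM2l// WM.
Qed.

(** [M] stays positive on a short interval starting at 0, and [p] has only finitely many roots
    there, so the integrand is positive at some interior point. *)
Let F_gt0 p : p != 0 -> 0 < F p.
Proof.
move=> p0.
have : \forall s \near 0, 0 < M s by apply: (cvgr_gt (M 0) (cM (x := _))).
move=> /nbhs_ballP[d /= d0 Md].
pose d' := Num.min d t.
have d'0 : 0 < d' by rewrite lt_min d0.
have [d'd d't] : d' <= d /\ d' <= t by rewrite /d' !ge_min !lexx orbT.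
have [r [h [pE _ _ hn]]] := poly_factor_itv d' p0.
(* Pigeonhole: [(size r).+1] distinct points cannot all belong to [r]. The denominator starts at 2
   to stay strictly below [d']. *)
have [n nr] : exists n : nat, d' / n.+2%:R \notin r.
  pose rs := [seq d' / n.+2%:R | n <- iota 0 (size r).+1].
  have urs : uniq rs.
    rewrite map_inj_uniq ?iota_uniq// => i j /(mulfI (lt0r_neq0 d'0))/invr_inj/eqP.
    by rewrite eqr_nat => /eqP[].
  have : ~~ all [in r] rs.
    apply/negP => /allP sub; have := uniq_leq_size urs sub.
    by rewrite size_map size_iota ltnn.
  by move=> /allPn[x /mapP[n _ ->]]; exists n.
pose x := d' / n.+2%:R.
have x0 : 0 < x by rewrite divr_gt0// ltr0n.
have xd : x < d' by rewrite ltr_pdivrMr ?ltr0n// ltr_pMr// ltr1n.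
apply: (@integ_gt0 _ _ _ _ x); first exact: cpM.
- by move=> s st; rewrite mulr_ge0// M_ge0.
- by apply/andP; split => //; exact: lt_le_trans xd d't.
apply: mulr_gt0.
  rewrite normr_gt0 pE hornerM mulf_neq0//; first by rewrite hn// x0.
  rewrite horner_prod; rewrite prodf_seq_neq0; apply/allP => z zr /=.
  by rewrite hornerXsubC subr_eq0; apply: contraNneq nr => xz; rewrite -/x xz.
apply: Md; rewrite /ball/= sub0r normrN gtr0_norm//; exact: lt_le_trans xd d'd.
Qed.

(** Coefficient vectors make the polynomials of degree at most [m] a finite-dimensional normed
    space, whose unit sphere is compact. *)
Let pl (a : 'rV[R]_m.+1) : {poly R} := rVpoly a.

(** Each coefficient of [pl a] is at most the max norm of [a]; [C] is the resulting bound on [F] and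
    serves as Lipschitz constant for both [F] and [y]. *)
Let C := integ 0 t (fun s => (\sum_(i < m.+1) `|s| ^+ i) * M s).

Let normr_le_rV (a : 'rV[R]_m.+1) i : `|a 0 i| <= `|a|.
Proof.
by rewrite [leRHS]/Num.norm /= mx_normrE; apply/bigmax_geP; right; exists (0, i).
Qed.

Let F_le_norm a : F (pl a) <= C * `|a|.
Proof.
have cS : continuous (fun s : R => (\sum_(i < m.+1) `|s| ^+ i) * M s).
  move=> s; apply: cvgM; last exact: cM.
  apply: cvg_sum_real => i _.
  by apply: (@continuous_comp _ _ _ (fun s : R => `|s|) (fun x => x ^+ i));
    [exact: norm_continuous|exact: exprn_continuous].
rewrite mulrC /C -integZ//; apply: le_integ => //.
  by move=> s; apply: cvgM; [exact: cvg_cst|exact: cS].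
move=> s st; rewrite mulrA ler_wpM2r ?M_ge0//.
rewrite /pl horner_poly mulr_sumr; apply: le_trans (ler_norm_sum _ _ _) _.
apply: ler_sum => i _; rewrite valK normrM normrX ler_wpM2r//.
Qed.

Let cF : continuous (F \o pl).
Proof.
apply: (@lipschitz_continuous _ _ C) => a b /=.
have H x z : F (pl x) - F (pl z) <= C * `|x - z|.
  rewrite lerBlDr; apply: le_trans (_ : F (pl (x - z)) + F (pl z) <= _).
    by rewrite -{1}(subrK z x) /pl linearD/= -/(pl _); exact: FD.
  by rewrite lerD2r F_le_norm.
by rewrite ler_norml H andbT lerNl opprB distrC H.
Qed.

Let cy : continuous (y \o pl).
Proof.
apply: (@lipschitz_continuous _ _ C) => a b /=.
apply: le_trans (F_le_norm _); apply: le_trans (normy _).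
have -> : pl (a - b) = pl a + (-1) *: pl b by rewrite /pl linearB scaleN1r.
by rewrite yD yZ mulN1r.
Qed.

Lemma moments_bang_bang : exists (r : seq R) (e : bool) (K : R),
  [/\ (size r <= m)%N, sorted <=%R (0 :: r), all (fun x => x <= t) r,
    0 <= K <= 1 &
    forall q : {poly R}, (size q <= m.+1)%N ->
      integ 0 t (fun s => q.[s] * W s) = K * (-1) ^+ e *
        \sum_(k < m.+1) (-1) ^+ k *
          integ (nth t (0 :: r) k) (nth t r k) (fun s => q.[s] * M s)].
Proof.
(* The quotient is invariant under positive scaling, so maximising it over the unit sphere is
   enough. *)
pose S := [set a : 'rV[R]_m.+1 | `|a| = 1].
have pl0 a : a != 0 -> pl a != 0.
  by apply: contra_neq => h; rewrite -(rVpolyK a) -/(pl a) h linear0.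
have plZ k a : pl (k *: a) = k *: pl a by rewrite /pl linearZ.
have norm0 (a : 'rV[R]_m.+1) : `|a| = 1 -> a != 0.
  by move=> a1; rewrite -normr_eq0 a1 oner_neq0.
have [] := @compact_EVT_max _ R (fun a => y (pl a) / F (pl a)) S.
- have c0 : const_mx 1 != 0 :> 'rV[R]_m.+1.
    by apply/eqP => /matrixP/(_ 0 0); rewrite !mxE => /eqP; rewrite oner_eq0.
  exists (`|const_mx 1 : 'rV[R]_m.+1|^-1 *: const_mx 1); rewrite /S/= normrZ.
  by rewrite ger0_norm ?invr_ge0// mulVf// normr_eq0.
- apply: bounded_closed_compact.
    by exists 1; split => // x x1 a; rewrite /S/= => ->; exact: ltW.
  apply: (@closed_comp _ _ (fun a : 'rV[R]_m.+1 => `|a|) [set x | x = 1]).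
    by move=> a _; exact: norm_continuous.
  exact: closed_eq.
- apply: continuous_in_subspaceT => a; rewrite inE /S/= => a1.
  have h : (fun b => (F (pl b))^-1) @ a --> (F (pl a))^-1.
    by apply: (cvgV _ (@cF a)); rewrite gt_eqF// F_gt0// pl0// norm0.
  exact: (cvgM (@cy a) h).
move=> c; rewrite inE /S/= => c1 cmax.
pose K := y (pl c) / F (pl c).
have Fc : 0 < F (pl c) by rewrite F_gt0// pl0// norm0.
have yc : y (pl c) = K * F (pl c) by rewrite /K divfK// gt_eqF.
(* Homogeneity carries the bound from the sphere to every vector. *)
have yKF a : y (pl a) <= K * F (pl a).
  have [->|a0] := eqVneq a 0.
    by rewrite -(scale0r (0 : 'rV[R]_m.+1)) plZ yZ FZ normr0 !mul0r mulr0.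
  have na : 0 < `|a| by rewrite normr_gt0.
  have := cmax (`|a|^-1 *: a); rewrite inE /S/= normrZ ger0_norm ?invr_ge0//.
  rewrite mulVf ?gt_eqF// => /(_ erefl).
  rewrite plZ yZ FZ ger0_norm ?invr_ge0// invfM invrK mulrACA mulVf ?gt_eqF// mul1r.
  by rewrite ler_pdivrMr// F_gt0// pl0.
(* The bound at [- c] reads [- K * F (pl c) <= K * F (pl c)]. *)
have K0 : 0 <= K.
  have := yKF (- c); rewrite -scaleN1r plZ yZ FZ normrN1 mul1r yc.
  by rewrite mulN1r -subr_ge0 opprK -mulr2n pmulrn_lge0// pmulr_lge0.
have K1 : K <= 1.
  by rewrite /K ler_pdivrMr// mul1r; apply: le_trans (normy _); exact: ler_norm.
have [r [e [sr sor rt sgn]]] := poly_sign_pattern t0 (pl0 _ (norm0 _ c1)).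
have srm : (size r <= m)%N.
  by rewrite -ltnS; apply: leq_trans sr _; exact: size_poly.
pose sg k := nth t (0 :: r) k.
have sgS k : sg k <= sg k.+1 by apply: nth_switch_le => //; exact: ltW.
have sgt : sg m.+1 = t by rewrite /sg nth_default.
(* [L q] is the directional derivative of [F] at [pl c] along [q]: the integral of [M q] against the
   sign of [pl c], cut at the switching times. *)
pose L (q : {poly R}) := (-1) ^+ e * \sum_(k < m.+1) (-1) ^+ k *
          integ (nth t (0 :: r) k) (nth t r k) (fun s => q.[s] * M s).
exists r, e, K; split => //; first by rewrite K0.
(* Both sides are odd in [q], so the inequality at [- q] gives the reverse one. *)
suff main (q : {poly R}) : (size q <= m.+1)%N -> y q <= K * L q.
  move=> q sq; rewrite -mulrA -/(L q); apply/eqP; rewrite eq_le main//=.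
  have := main (- q); rewrite size_polyN => /(_ sq).
  have -> : L (- q) = - L q.
    rewrite /L -mulrN -sumrN; congr (_ * _); apply: eq_bigr => k _.
    rewrite -mulrN; congr (_ * _); rewrite -mulN1r -integZ.
      by apply: eq_integ => s _; rewrite hornerN; ring.
    by move=> s; apply: cvgM; [exact: continuous_horner|exact: cM].
  by rewrite -[- q]scaleN1r yZ mulN1r mulrN lerN2.
move=> sq.
have plq : pl (poly_rV q) = q by rewrite /pl poly_rV_K.
(* Difference quotients of [F] with step [1 / n.+1]. As [K F - y] is nonnegative and vanishes at
   [pl c], each satisfies [y q <= K * G n], and the limit gives the claim. *)
pose G n := n.+1%:R * (F (pl c + n.+1%:R^-1 *: q) - F (pl c)).
have yG n : y q <= K * G n.
  have n0 : 0 < n.+1%:R :> R by rewrite ltr0n.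
  have := yKF (c + n.+1%:R^-1 *: poly_rV q).
  have -> : pl (c + n.+1%:R^-1 *: poly_rV q) = pl c + n.+1%:R^-1 *: q.
    by rewrite -{2}plq -plZ /pl linearD.
  rewrite yD yZ yc -lerBrDl -mulrBr ler_pdivrMl// => h.
  by apply: le_trans h _; rewrite /G mulrCA.
have GL : G @ \oo --> L q.
  have GE n : G n = \sum_(k < m.+1) n.+1%:R *
      (integ (sg k) (sg k.+1) (fun s => `|(pl c).[s] + n.+1%:R^-1 * q.[s]| * M s)
       - integ (sg k) (sg k.+1) (fun s => `|(pl c).[s]| * M s)).
    rewrite /G -mulr_sumr; congr (_ * _); rewrite sumrB.
    have sg0 : 0 = sg 0%N by [].
    rewrite /F -sgt {1}sg0 [in X in _ - X]sg0 !integ_chain//; congr (_ - _).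
    by apply: eq_bigr => k _; apply: eq_integ => s _; rewrite hornerD hornerZ.
  rewrite (_ : G = fun n => \sum_(k < m.+1) n.+1%:R *
      (integ (sg k) (sg k.+1) (fun s => `|(pl c).[s] + n.+1%:R^-1 * q.[s]| * M s)
       - integ (sg k) (sg k.+1) (fun s => `|(pl c).[s]| * M s))); last first.
    by apply/funext.
  rewrite /L mulr_sumr.
  apply: cvg_sum_real => k _.
  rewrite mulrA -(signr_odd _ k) -signr_addb.
  apply: cvg_diff_quotient_integ_abs => //; [exact: continuous_horner..|].
  move=> s hs; rewrite signr_addb signr_odd.
  (* Past the last root both end points equal [t], so the open piece is empty. *)
  have [kr|kr] := leqP k (size r); first exact: sgn.
  have h1 : sg k = t by rewrite /sg nth_default.
  have h2 : sg k.+1 = t by rewrite /sg nth_default//= ltnS ltnW.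
  by move: hs; rewrite h1 h2 => /andP[/lt_trans h3 /h3]; rewrite ltxx.
have : K * G n @[n --> \oo] --> K * L q by apply: cvgM => //; exact: cvg_cst.
move=> /(ler_cvg_to (cvg_cst (y q))); apply.
by apply: nearW.
Qed.

End Moments.

(** * Solution formula for the chain of integrators *)

Section Trajectory.
Context {R : realType}.
Implicit Types (t s : R) (z : nat -> R -> R).

(** Taylor's formula in differential form: differentiating the weight of each term cancels the
    derivative of the sum before it, and only the top term survives. *)
Lemma is_derive_taylor t z n s :
  (forall k, (k <= n)%N -> is_derive s 1 (z k) (z k.+1 s)) ->
  is_derive s 1 (fun r => \sum_(l < n.+1) (t - r) ^+ l / l`!%:R * z l r)
    ((t - s) ^+ n / n`!%:R * z n.+1 s).
Proof.
elim: n => [|n ih] dz.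
  have -> : (fun r => \sum_(l < 1) (t - r) ^+ l / l`!%:R * z l r) = z 0%N.
    by apply/funext => r; rewrite big_ord1 expr0 fact0 divr1 mul1r.
  by rewrite expr0 fact0 divr1 mul1r; exact: dz.
pose G r := \sum_(l < n.+1) (t - r) ^+ l / l`!%:R * z l r.
pose H r := (t - r) ^+ n.+1 / n.+1`!%:R.
have -> : (fun r => \sum_(l < n.+2) (t - r) ^+ l / l`!%:R * z l r) =
    G \+ (H \* z n.+1).
  by apply/funext => r; rewrite big_ord_recr.
have dG : is_derive s 1 G ((t - s) ^+ n / n`!%:R * z n.+1 s).
  by apply: ih => k kn; apply: dz; rewrite leqW.
have dH : is_derive s 1 H (- ((t - s) ^+ n / n`!%:R)).
  have d1 := is_deriveB (is_derive_cst t s 1) (is_derive_id s (1 : R)).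
  have := is_deriveZ n.+1`!%:R^-1 (is_deriveX n.+1 d1).
  have -> : n.+1`!%:R^-1 \*: ((cst t - id : R -> R) ^+ n.+1) = H.
    by apply/funext => r; rewrite /H mulrC exprfctE.
  move=> hH; apply: (is_derive_eq hH).
  rewrite !fctE /GRing.scale /= sub0r factS natrM invfM.
  have n0 : n.+1%:R != 0 :> R by rewrite pnatr_eq0.
  have n1 : n`!%:R != 0 :> R by rewrite pnatr_eq0 -lt0n fact_gt0.
  move: n0 n1; move: (n.+1%:R : R) (n`!%:R : R) => p q p0 q0.
  by field; rewrite p0 q0.
have dzn := dz n.+1 (leqnn _).
apply: is_derive_eq.
rewrite /GRing.scale /=.
by rewrite /H; ring.
Qed.

(** The fundamental theorem of calculus applied to the Taylor sum [G]: it equals the coordinate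
    [x t i 0] at time [t] and the polynomial in the initial state at time 0. *)
Lemma integrator_trajectory (m : nat) t (u : R -> R) (x : R -> 'cV[R]_m.+1) :
  0 < t -> {within `[0, t], continuous u} ->
  (forall i, {within `[0, t], continuous (fun r => x r i 0)}) ->
  (forall s, 0 < s < t -> forall i, is_derive s 1 (fun r => x r i 0)
     ((Aint R m *m x s) i 0 + bcon R m i 0 * u s)) ->
  forall i, x t i 0 =
    \sum_(j < m.+1 | (i <= j)%N) t ^+ (j - i) / (j - i)`!%:R * x 0 j 0 +
    integ 0 t (fun s => u s * xi m (t - s) i 0).
Proof.
move=> t0 cu cx dx i.
(* The successive derivatives of coordinate [i] are the coordinates after it, and then the input
   [u]. *)
pose z l r := if (i + l <= m)%N then x r (inord (i + l)) 0 else u r.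
pose n := (m - i)%N.
have im : (i <= m)%N by rewrite -ltnS.
pose G r := \sum_(l < n.+1) (t - r) ^+ l / l`!%:R * z l r.
have cz l : {within `[0, t], continuous (z l)}.
  by rewrite /z; case: (i + l <= m)%N; [exact: cx|exact: cu].
have dz s l : 0 < s < t -> (l <= n)%N -> is_derive s 1 (z l) (z l.+1 s).
  move=> st ln; rewrite /z.
  have iln : (i + l <= m)%N by rewrite /n in ln; lia.
  rewrite iln.
  have := dx s st (inord (i + l)).
  congr is_derive.
  rewrite !mxE inordK ?ltnS//.
  under eq_bigr do rewrite !mxE inordK ?ltnS//.
  rewrite addnS; case: ltnP => ilm.
    rewrite (bigD1 (inord (i + l).+1))//= inordK ?ltnS// eqxx mul1r big1 ?addr0.
      by rewrite ltn_eqF// mul0r addr0.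
    move=> j /eqP jn; case: eqP => [jE|]; last by rewrite mul0r.
    by exfalso; apply: jn; apply/val_inj; rewrite /= inordK ?ltnS.
  rewrite big1; last by move=> j _; rewrite mul0r.
  by rewrite add0r eqn_leq iln ilm mul1r.
have dG s : 0 < s < t -> is_derive s 1 G ((t - s) ^+ n / n`!%:R * u s).
  move=> st; have := @is_derive_taylor t z n s (fun k => dz s k st).
  by rewrite /z addnS (subnKC im) ltnn.
have cpow l : continuous (fun r : R => (t - r) ^+ l / l`!%:R).
  move=> r; apply: cvgM; last exact: cvg_cst.
  apply: (@continuous_comp _ _ _ (fun r : R => t - r) (fun x => x ^+ l)).
    by apply: cvgB; [exact: cvg_cst|exact: cvg_id].
  exact: exprn_continuous.
have cG : {within `[0, t], continuous G}.
  move=> r; apply: cvg_sum_real => l _; apply: cvgM; last exact: cz.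
  by apply: (continuous_subspaceT (@cpow l)).
have cf : {within `[0, t], continuous (fun s => u s * xi m (t - s) i 0)}.
  have -> : (fun s => u s * xi m (t - s) i 0) =
      (fun s => u s * ((t - s) ^+ n / n`!%:R)).
    by apply/funext => s; rewrite mxE.
  move=> r; apply: cvgM; first exact: cu.
  by apply: (continuous_subspaceT (@cpow n)).
have := @continuous_FTC2 R (fun s => u s * xi m (t - s) i 0) G 0 t t0 cf.
case/(continuous_within_itvP _ t0): cG => _ c1 c2.
have H1 : derivable_oo_LRcontinuous G 0 t.
  by split => // s; rewrite in_itv/= => st; have [] := dG s st.
have H2 : {in `]0, t[, derive1 G =1 (fun s => u s * xi m (t - s) i 0)}.
  move=> s; rewrite in_itv/= => st; rewrite derive1E; have [_ ->] := dG s st.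
  by rewrite mxE mulrC.
move=> /(_ H1 H2) E.
have Gt : G t = x t i 0.
  rewrite /G big_ord_recl subrr expr0 fact0 divr1 mul1r big1 ?addr0.
    by rewrite /z addn0 im inord_val.
  by move=> l _; rewrite /= /bump leq0n add1n expr0n/= !mul0r.
have G0 : G 0 = \sum_(j < m.+1 | (i <= j)%N) t ^+ (j - i) / (j - i)`!%:R * x 0 j 0.
  (* The summand is extended to all natural indices so that the sum can be shifted to
     [l = j - i]. *)
  pose g (j : nat) := t ^+ (j - i) / (j - i)`!%:R * x 0 (inord j) 0.
  transitivity (\sum_(j < m.+1 | (i <= j)%N) g j); last first.
    by apply: eq_bigr => j _; rewrite /g inord_val.
  rewrite -(big_geq_mkord _ _ predT) -{1}(add0n (i : nat)) big_addn subSn// big_mkord.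
  apply: eq_bigr => l _; rewrite /g addnK subr0 /z addnC.
  by rewrite ifT// addnC -leq_subRL// -ltnS.
have E' : integ 0 t (fun s => u s * xi m (t - s) i 0) = G t - G 0.
  by rewrite /integ /Rintegral E.
by rewrite E' G0 Gt addrC subrK.
Qed.

End Trajectory.

(** * Continuity of the matrix exponential in time *)

Section MatrixExponential.
Context {R : realType}.

Lemma is_cvg_pseries_exp_bound (a : R ^nat) (D B K : R) :
  (forall k, `|a k| <= D * (B ^+ k / k`!%:R)) -> cvgn (pseries a K).
Proof.
move=> aD; rewrite /pseries; apply: normed_cvg.
have aK k : `|a k * K ^+ k| <= D * exp_coeff (B * `|K|) k.
  rewrite normrM normrX /exp_coeff /= exprMn.
  have -> : D * (B ^+ k * `|K| ^+ k / k`!%:R) = D * (B ^+ k / k`!%:R) * `|K| ^+ k.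
    by ring.
  by rewrite ler_wpM2r ?exprn_ge0.
apply: (series_le_cvg _ _ aK) => [k|k|]; first exact: normr_ge0.
  exact: le_trans (aK k).
by apply: is_cvg_seriesZ; exact: is_cvg_series_exp_coeff.
Qed.

(** Formal differentiation preserves the exponential bound, up to a factor [B]. The series and its
    first two formal derivatives thus converge at [|x| + 1], beyond [x], and the sum is
    differentiable at [x]. *)
Lemma pseries_exp_bound_continuous (a : R ^nat) (D B : R) :
  (forall k, `|a k| <= D * (B ^+ k / k`!%:R)) ->
  continuous (fun s => limn (pseries a s)).
Proof.
move=> aD x.
have diff (c : R^nat) (E : R) : (forall k, `|c k| <= E * (B ^+ k / k`!%:R)) ->
    forall k, `|pseries_diffs c k| <= (E * B) * (B ^+ k / k`!%:R).
  move=> cE k; rewrite /pseries_diffs normrM normr_nat.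
  apply: le_trans (ler_wpM2l _ (cE k.+1)) _ => //.
  have k0 : k.+1%:R != 0 :> R by rewrite pnatr_eq0.
  rewrite factS natrM invfM exprS.
  have -> // : k.+1%:R * (E * (B * B ^+ k * (k.+1%:R^-1 * k`!%:R^-1))) =
     E * B * (B ^+ k / k`!%:R) * (k.+1%:R * k.+1%:R^-1) by ring.
  by rewrite divff// mulr1.
have c0 : cvgn (pseries a (`|x| + 1)) by exact: is_cvg_pseries_exp_bound aD.
have c1 : cvgn (pseries (pseries_diffs a) (`|x| + 1)).
  exact: is_cvg_pseries_exp_bound (diff _ _ aD).
have c2 : cvgn (pseries (pseries_diffs (pseries_diffs a)) (`|x| + 1)).
  exact: is_cvg_pseries_exp_bound (diff _ _ (diff _ _ aD)).
have := @pseries_snd_diffs R a (`|x| + 1) x c0 c1 c2.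
rewrite [ltRHS]ger0_norm ?addr_ge0// ltrDl ltr01 => /(_ isT) [dx _].
by apply: differentiable_continuous; apply/derivable1_diffP.
Qed.

(** Induction on [k], since the absolute row sum of [X] is at most its sum over all entries. *)
Lemma normr_expmx_le (m : nat) (X : 'M[R]_m.+1) k i j :
  `|(X ^+ k) i j| <= (\sum_i \sum_j `|X i j|) ^+ k.
Proof.
elim: k i j => [|k ih] i j.
  by rewrite !expr0 mxE; case: (i == j); rewrite ?normr0 ?normr1 ?ler01.
rewrite !exprS mxE; apply: le_trans (ler_norm_sum _ _ _) _.
apply: le_trans (_ : \sum_l `|X i l| * (\sum_i \sum_j `|X i j|) ^+ k <= _).
  by apply: ler_sum => l _; rewrite normrM ler_wpM2l.
rewrite -mulr_suml ler_wpM2r//.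
  by rewrite exprn_ge0// sumr_ge0// => ? _; rewrite sumr_ge0.
rewrite [leRHS](bigD1 i)//= lerDl sumr_ge0// => ? _; exact: sumr_ge0.
Qed.

Lemma mexp_continuous (m : nat) (X : 'M[R]_m.+1) i j :
  continuous (fun s : R => mexp (s *: X) i j).
Proof.
pose a k := (X ^+ k) i j / k`!%:R.
have -> : (fun s : R => mexp (s *: X) i j) = (fun s => limn (pseries a s)).
  apply/funext => s; rewrite mxE; congr (limn _); apply/funext => K.
  rewrite /pseries /series /= big_mkord; apply: eq_bigr => k _.
  by rewrite exprZn mxE /a; ring.
apply: (@pseries_exp_bound_continuous _ 1 (\sum_i \sum_j `|X i j|)) => k.
by rewrite mul1r normrM normfV normr_nat ler_wpM2r// normr_expmx_le.
Qed.

Lemma dotc_mexp_continuous (m : nat) (c : 'cV[R]_m.+1) (X : 'M[R]_m.+1)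
  (v : 'cV[R]_m.+1) : continuous (fun s : R => dotc c (mexp (s *: X) *m v)).
Proof.
move=> s; apply: cvg_sum_real => i _; apply: cvgM; first exact: cvg_cst.
have -> : (fun s => (mexp (s *: X) *m v) i 0) =
    (fun s => \sum_j mexp (s *: X) i j * v j 0).
  by apply/funext => r; rewrite mxE.
rewrite mxE; apply: cvg_sum_real => j _; apply: cvgM; last exact: cvg_cst.
exact: mexp_continuous.
Qed.

End MatrixExponential.

(** * Extension of functions from an interval to the line *)

Section Clamp.
Context {R : realType}.
Implicit Types (a b x y : R) (f : R -> R).

(** The retraction of the line onto [[a, b]]. Composing with it turns continuity within the interval
    into the global continuity asked for by the integral lemmas. *)
Definition clamp a b x : R := Num.max a (Num.min x b).

Lemma clamp_itv a b x : a <= b -> a <= clamp a b x <= b.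
Proof.
by move=> ab; rewrite /clamp le_max lexx ge_max ab ge_min lexx orbT.
Qed.

Lemma clamp_id a b x : a <= x <= b -> clamp a b x = x.
Proof. by move=> /andP[ax xb]; rewrite /clamp min_l// max_r. Qed.

Lemma clamp_lipschitz a b x y : `|clamp a b x - clamp a b y| <= `|x - y|.
Proof.
rewrite /clamp ler_norml !maxEle !minEle.
have /ler_normlP[h1 h2] := lexx `|x - y|.
by case: (leP x b) => ?; case: (leP y b) => ?; repeat case: (leP a _) => ?; apply/andP; split; lra.
Qed.

Lemma continuous_comp_clamp a b f : a <= b -> {within `[a, b], continuous f} ->
  continuous (f \o clamp a b).
Proof.
move=> ab /subspace_continuousP cf x.
have cl : continuous (clamp a b).
  apply: (@lipschitz_continuous _ _ _ 1) => u v.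
  by rewrite mul1r clamp_lipschitz.
have hx : `[a, b]%classic (clamp a b x) by rewrite /= in_itv/= clamp_itv.
apply: cvg_comp (cf _ hx).
move=> P hP; rewrite /nbhs/=.
have : nbhs x (clamp a b @^-1` [set z | `[a, b]%classic z -> P z]) := cl x _ hP.
apply: (@filterS _ (nbhs x)) => y; apply.
by rewrite /= in_itv/= clamp_itv.
Qed.

Lemma lipschitz_comp_clamp f a b D : a <= b -> 0 <= D ->
  (forall x y, a <= x -> x <= y -> y <= b -> `|f x - f y| <= D * (y - x)) ->
  continuous (f \o clamp a b).
Proof.
move=> ab D0 fD; apply: (@lipschitz_continuous _ _ _ D) => x y /=.
apply: le_trans (_ : D * `|clamp a b x - clamp a b y| <= _); last first.
  by rewrite ler_wpM2l// clamp_lipschitz.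
have /andP[hx1 hx2] := clamp_itv x ab; have /andP[hy1 hy2] := clamp_itv y ab.
have [xy|/ltW yx] := leP (clamp a b x) (clamp a b y).
  by rewrite [X in D * X]distrC [X in D * X]ger0_norm ?subr_ge0//; exact: fD.
by rewrite distrC [X in D * X]ger0_norm ?subr_ge0//; exact: fD.
Qed.

End Clamp.

(** * Suprema and infima of images *)

Section SupFamily.
Context {R : realType} {T : Type}.

Lemma sup_image_le (A : set T) (f g : T -> R) (D : R) : A !=set0 ->
  has_ubound (g @` A) -> (forall w, A w -> f w <= g w + D) ->
  sup (f @` A) <= sup (g @` A) + D.
Proof.
move=> [w0 Aw0] gub fg; apply: ge_sup; first by exists (f w0); exists w0.
move=> _ [w Aw <-]; apply: le_trans (fg w Aw) _; rewrite lerD2r.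
by apply: ub_le_sup => //; exists w.
Qed.

Lemma inf_image (A : set T) (f : T -> R) :
  inf (f @` A) = - sup ((fun w => - f w) @` A).
Proof. by rewrite /inf image_comp. Qed.

End SupFamily.

(** * Continuity in time of the extremal values, and their values at time 0 *)

Section Extremal.
Context {R : realType} (g : R -> R) (vmin vmax t : R)
  (cg : continuous g) (vv : vmin <= vmax) (t0 : 0 <= t).

Let bd : set (R -> R) :=
  [set w | continuous w /\ forall r, vmin <= w r <= vmax].
Let J (s : R) (w : R -> R) := w 0 - integ 0 s (fun r => g r * w r).

(* Reading the input backwards from time [s] makes the constraint set
   independent of [s]. *)
Lemma image_adm_reflect s : 0 <= s ->
  [set v s - integ 0 s (fun tau => g (s - tau) * v tau) | v in adm vmin vmax s] =
  J s @` bd.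
Proof.
move=> s0; apply/seteqP; split => [_ [v [cv vb] <-]|_ [w [cw wb] <-]].
  (* Extended by constants outside [[0, s]], the input has a reflection that is continuous and
     bounded on the whole line. *)
  pose v' := v \o clamp 0 s.
  have cv' : continuous v' by exact: continuous_comp_clamp.
  have v'E r : 0 <= r <= s -> v' r = v r by move=> hr; rewrite /v' /= clamp_id.
  have cs : continuous (fun r : R => s - r).
    by move=> r; apply: cvgB; [exact: cvg_cst|exact: cvg_id].
  exists (fun r => v' (s - r)).
    split=> [r|r]; last by apply: vb; exact: clamp_itv.
    by apply: (@continuous_comp _ _ _ (fun r : R => s - r) v'); [exact: cs|exact: cv'].
  rewrite /J subr0 v'E ?s0 ?lexx//; congr (_ - _).
  transitivity (integ 0 s (fun tau => g (s - tau) * v' tau)); last first.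
    by apply: eq_integ => r hr; rewrite v'E.
  rewrite -[RHS]integ_reflect//.
    by apply: eq_integ => r hr; rewrite subKr.
  move=> r; apply: cvgM; last exact: cv'.
  by apply: (@continuous_comp _ _ _ (fun r : R => s - r) g); [exact: cs|exact: cg].
exists (fun r => w (s - r)).
  split; last by move=> tau _; exact: wb.
  apply: continuous_subspaceT => r.
  apply: (@continuous_comp _ _ _ (fun r : R => s - r) w); last exact: cw.
  by apply: cvgB; [exact: cvg_cst|exact: cvg_id].
rewrite /J subrr; congr (_ - _).
rewrite -[RHS](integ_reflect s0)//.
by move=> r; apply: cvgM; [exact: cg|exact: cw].
Qed.

Let bd0 : bd !=set0.
Proof. by exists (cst vmin); split => [|r]; [exact: cst_continuous|rewrite /= lexx]. Qed.

Let V := `|vmin| + `|vmax|.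

Let bdV w r : bd w -> `|w r| <= V.
Proof.
move=> [_ /(_ r) h]; rewrite /V ler_norml.
have /ler_normlP[h1 h2] := lexx `|vmin|; have /ler_normlP[h3 h4] := lexx `|vmax|.
have := normr_ge0 vmin; have := normr_ge0 vmax; lra.
Qed.

(** The difference is the integral of [g * w] over [[s, s']]; the maximum of [|g|] on [[0, t]] times
    [V] bounds the integrand for every [w] at once. *)
Let J_lipschitz : exists2 D, 0 <= D & forall w s s', bd w -> 0 <= s -> s <= s' -> s' <= t ->
  `|J s w - J s' w| <= D * (s' - s).
Proof.
have [c _ gc] : exists2 c, c \in `[0, t] & forall r, r \in `[0, t] -> `|g r| <= `|g c|.
  apply: EVT_max => //; apply: continuous_subspaceT => r.
  by apply: cvg_norm; exact: cg.
exists (`|g c| * V) => [|w s s' bw]; first by rewrite mulr_ge0// addr_ge0.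
move=> s0 ss' st; have [cw _] := bw.
have cgw : continuous (fun r => g r * w r) by move=> r; apply: cvgM; [exact: cg|exact: cw].
rewrite /J (integ_split s0 ss')//.
have -> : forall x y z : R, x - y - (x - (y + z)) = z by move=> *; ring.
apply: le_trans (normr_integ _ _ cgw) _.
rewrite -integ_cst//; apply: le_integ.
- by move=> r; apply: cvg_norm; exact: cgw.
- exact: cst_continuous.
move=> r hr; rewrite normrM ler_pM//; last exact: bdV.
apply: gc; rewrite in_itv/=; lra.
Qed.

Let J0 w : J 0 w = w 0.
Proof. by rewrite /J integ1 subr0. Qed.

Let J_bounded : exists B, forall w s, bd w -> 0 <= s <= t -> `|J s w| <= B.
Proof.
have [D D0 HD] := J_lipschitz.
exists (V + D * t) => w s bw /andP[s0 st].
have := HD w 0 s bw (lexx _) s0 st; rewrite J0 subr0 => h.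
have h1 : D * s <= D * t.
  by rewrite ler_wpM2l.
have h2 := bdV 0 bw.
have -> : J s w = w 0 - (w 0 - J s w) by ring.
apply: le_trans (ler_normB _ _) _; lra.
Qed.

(** A Lipschitz constant common to the family passes to its supremum. The case [- J] serves the
    infimum. *)
Let sup_lipschitz (f : R -> (R -> R) -> R) : (f = J \/ f = fun s w => - J s w) ->
  continuous ((fun s => sup (f s @` bd)) \o clamp 0 t).
Proof.
move=> fJ; have [D D0 HD] := J_lipschitz; have [B HB] := J_bounded.
apply: (@lipschitz_comp_clamp _ _ _ _ D) => // s s' s0 ss' st.
have H w : bd w -> `|f s w - f s' w| <= D * (s' - s).
  move=> bw; have := HD w s s' bw s0 ss' st.
  by case: fJ => -> //; rewrite -opprB normrN opprK addrC.
have ub r : 0 <= r <= t -> has_ubound (f r @` bd).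
  move=> hr; exists B => _ [w bw <-]; apply: le_trans (ler_norm _) _.
  by case: fJ => ->; rewrite ?normrN; exact: HB.
have i1 : sup (f s @` bd) <= sup (f s' @` bd) + D * (s' - s).
  apply: sup_image_le => //; first by apply: ub; lra.
  by move=> w /H /ler_normlP[]; lra.
have i2 : sup (f s' @` bd) <= sup (f s @` bd) + D * (s' - s).
  apply: sup_image_le => //; first by apply: ub; lra.
  by move=> w /H /ler_normlP[]; lra.
rewrite ler_norml; lra.
Qed.

Lemma sup_adm_continuous : continuous ((fun s =>
  sup [set v s - integ 0 s (fun tau => g (s - tau) * v tau) | v in adm vmin vmax s])
  \o clamp 0 t).
Proof.
have c := @sup_lipschitz J (or_introl erefl).
have -> : (fun s =>
  sup [set v s - integ 0 s (fun tau => g (s - tau) * v tau) | v in adm vmin vmax s])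
  \o clamp 0 t = (fun s => sup (J s @` bd)) \o clamp 0 t.
  apply/funext => x /=; rewrite image_adm_reflect//.
  by have /andP[] := clamp_itv x t0.
exact: c.
Qed.

Lemma inf_adm_continuous : continuous ((fun s =>
  inf [set v s - integ 0 s (fun tau => g (s - tau) * v tau) | v in adm vmin vmax s])
  \o clamp 0 t).
Proof.
have c := @sup_lipschitz _ (or_intror erefl).
have -> : (fun s =>
  inf [set v s - integ 0 s (fun tau => g (s - tau) * v tau) | v in adm vmin vmax s])
  \o clamp 0 t = fun x => - ((fun s => sup ((fun w => - J s w) @` bd)) \o clamp 0 t) x.
  apply/funext => x /=; rewrite image_adm_reflect ?inf_image//.
  by have /andP[] := clamp_itv x t0.
by move=> x; apply: cvgN; exact: c.
Qed.

(** At time 0 the integral vanishes and only the bound on [w 0] remains. Together with [inf_adm0]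
    this makes [mu] positive at 0 when [vmin < vmax], as [moments_bang_bang] requires. *)
Lemma sup_adm0 :
  sup [set v 0 - integ 0 0 (fun tau => g (0 - tau) * v tau) | v in adm vmin vmax 0]
  = vmax.
Proof.
rewrite image_adm_reflect//; apply/eqP; rewrite eq_le; apply/andP; split.
  apply: ge_sup; first by case: bd0 => w bw; exists (J 0 w); exists w.
  by move=> _ [w [_ /(_ 0) /andP[_ h]] <-]; rewrite J0.
apply: ub_le_sup.
  by exists vmax => _ [w [_ /(_ 0) /andP[_ h]] <-]; rewrite J0.
by exists (cst vmax); [split => [|r]; [exact: cst_continuous|rewrite /= lexx andbT]|rewrite J0].
Qed.

Lemma inf_adm0 :
  inf [set v 0 - integ 0 0 (fun tau => g (0 - tau) * v tau) | v in adm vmin vmax 0]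
  = vmin.
Proof.
rewrite image_adm_reflect//; apply/eqP; rewrite eq_le; apply/andP; split.
  apply: ge_inf.
    by exists vmin => _ [w [_ /(_ 0) /andP[h _]] <-]; rewrite J0.
  by exists (cst vmin); [split => [|r]; [exact: cst_continuous|rewrite /= lexx]|rewrite J0].
apply: lb_le_inf; first by case: bd0 => w bw; exists (J 0 w); exists w.
by move=> _ [w [_ /(_ 0) /andP[h _]] <-]; rewrite J0.
Qed.

End Extremal.

(** * Bang-bang representation of the reachable points *)

Lemma sig_ext_nth (R : realType) (m : nat) (t : R) (r : seq R) k :
  (size r <= m)%N -> (k <= m.+1)%N ->
  sig_ext t (fun i : 'I_m => nth t r i) k = nth t (0 :: r) k.
Proof.
move=> rm; case: k => [//|k]; rewrite ltnS /sig_ext /= => km.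
have [km'|mk] := ltnP k m.
  by rewrite (nth_map (Ordinal km')) ?size_enum_ord// nth_enum_ord.
rewrite !nth_default ?size_map//; first exact: leq_trans rm mk.
by rewrite -enumT size_enum_ord.
Qed.

(** Equal bounds leave one admissible input on [[0, s]], the constant [v0], so the functional takes
    a single value. This settles the case [vmin = vmax]. *)
Lemma adm_sup_eq_inf (R : realType) (g : R -> R) (v0 s : R) : 0 <= s ->
  sup [set v s - integ 0 s (fun tau => g (s - tau) * v tau) | v in adm v0 v0 s] =
  inf [set v s - integ 0 s (fun tau => g (s - tau) * v tau) | v in adm v0 v0 s].
Proof.
move=> s0.
have -> : [set v s - integ 0 s (fun tau => g (s - tau) * v tau) | v in adm v0 v0 s]
    = [set v0 - integ 0 s (fun tau => g (s - tau) * v0)].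
  apply/seteqP; split => [_ [v [_ vb] <-]|_ ->].
    have vE r : 0 <= r <= s -> v r = v0.
      by move=> /vb /andP[h1 h2]; apply/eqP; rewrite eq_le h1 h2.
    rewrite /= vE ?s0 ?lexx//; congr (_ - _).
    by apply: eq_integ => r /vE ->.
  exists (cst v0) => //; split => [|r _]; last by rewrite /= lexx.
  by apply: continuous_subspaceT; exact: cst_continuous.
by rewrite sup1 inf1.
Qed.

(* The paper's dimension n is m.+1 here. *)
Theorem theorem3 (R : realType) (m : nat) (A : 'M[R]_m.+1) (b : 'cV[R]_m.+1)
    (vmin vmax : R) (z0 : 'cV[R]_m.+1) (t : R) :
  controllable A b -> distinct_eigenvalues A -> vmin <= vmax -> 0 < t ->
  forall x : 'cV[R]_m.+1, reach_set A b vmin vmax z0 t x ->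
  exists (sigma : 'I_m -> R) (lam : R),
    [/\ W_t t sigma, 0 <= lam <= 1 &
        x = pi_map A b vmin vmax z0 t sigma lam].
Proof.
move=> _ _ vv t0 _ [u [cu ub [x [x0E <- cx dx]]]].
have t0' := ltW t0.
(* [ffun s tau] is [g (s - tau)]: the integral in [Ifun] is a convolution. *)
pose g r := dotc (cvec A) (mexp (r *: Acon A) *m bcon R m).
pose h s := dotc (cvec A) (mexp (s *: Acon A) *m x0 A b z0).
have cg : continuous g by exact: dotc_mexp_continuous.
have ch : continuous (h \o clamp 0 t).
  apply: continuous_comp_clamp => //; apply: continuous_subspaceT.
  exact: dotc_mexp_continuous.
pose uM := umax A b vmin vmax z0; pose um := umin A b vmin vmax z0.
have cM : continuous (uM \o clamp 0 t).
  move=> s; apply: cvgD; first by apply: cvgN; exact: ch.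
  exact: (@sup_adm_continuous _ g vmin vmax t cg vv t0' s).
have cm : continuous (um \o clamp 0 t).
  move=> s; apply: cvgD; first by apply: cvgN; exact: ch.
  exact: (@inf_adm_continuous _ g vmin vmax t cg vv t0' s).
(* [MU], [NU] and [U] agree with [mu], [nu] and [u] on [[0, t]] and are continuous on the whole
   line. *)
pose MU := mu A b vmin vmax z0 \o clamp 0 t.
pose NU := nu A b vmin vmax z0 \o clamp 0 t.
pose U := u \o clamp 0 t.
have cMU : continuous MU.
  move=> s; apply: cvgM; last exact: cvg_cst.
  by apply: cvgB; [exact: cM|exact: cm].
have cNU : continuous NU.
  move=> s; apply: cvgM; last exact: cvg_cst.
  by apply: cvgD; [exact: cM|exact: cm].
have cU : continuous U by exact: continuous_comp_clamp.
pose W s := U s - NU s.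
have cW : continuous W by move=> s; apply: cvgB; [exact: cU|exact: cNU].
have WM s : 0 <= s <= t -> `|W s| <= MU s.
  move=> st; rewrite /W /MU /NU /U /= clamp_id// /mu /nu.
  have /andP[h1 h2] := ub s st; rewrite ler_norml; lra.
have [r [e [K [rm sor rt K01 HK]]]] : exists (r : seq R) (e : bool) (K : R),
  [/\ (size r <= m)%N, sorted <=%R (0 :: r), all (fun x => x <= t) r,
    0 <= K <= 1 &
    forall q : {poly R}, (size q <= m.+1)%N ->
      integ 0 t (fun s => q.[s] * W s) = K * (-1) ^+ e *
        \sum_(k < m.+1) (-1) ^+ k *
          integ (nth t (0 :: r) k) (nth t r k) (fun s => q.[s] * MU s)].
  (* If [vmin = vmax], then [mu] and hence [W] vanish on [[0, t]], so [K = 0] with an empty list of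
     switches will do. *)
  have [vE|vne] := eqVneq vmin vmax; last first.
    apply: moments_bang_bang => //.
    rewrite /MU /= clamp_id ?lexx// /mu /umax /umin.
    have -> : Imax A vmin vmax 0 = vmax by exact: (@sup_adm0 _ g).
    have -> : Imin A vmin vmax 0 = vmin by exact: (@inf_adm0 _ g).
    have : vmin < vmax by rewrite lt_neqAle vne.
    lra.
  exists [::], false, 0; split; rewrite ?lexx ?ler01// => q _.
  rewrite !mul0r (@eq_integ _ _ (fun=> 0)); first by rewrite integ_cst// mul0r.
  move=> s st; have MU0 : MU s = 0.
    rewrite /MU /= clamp_id// /mu /umax /umin -vE.
    have /andP[s0 _] := st.
    have -> : Imax A vmin vmin s = Imin A vmin vmin s.
      exact: (@adm_sup_eq_inf _ g).
    by rewrite subrr mul0r.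
  by have := WM s st; rewrite MU0 normr_le0 => /eqP ->; rewrite mulr0.
pose sigma (i : 'I_m) := nth t r i.
have sgE k : (k <= m.+1)%N -> sig_ext t sigma k = nth t (0 :: r) k.
  exact: sig_ext_nth.
have sgS k : nth t (0 :: r) k <= nth t r k by exact: nth_switch_le.
have sg_itv k : 0 <= nth t (0 :: r) k <= t.
  apply/andP; split.
    by elim: k => // k ih; exact: le_trans ih (sgS k).
  case: k => [//|k] /=; have [kr|?] := ltnP k (size r); last by rewrite nth_default.
  exact: (allP rt _ (mem_nth t kr)).
(* [pi_map] is [x_mid + (2 lam - 1) x_alt], so [lam] solves [2 lam - 1 = K (-1)^e]. *)
pose lam := (1 + K * (-1) ^+ e) / 2.
exists sigma, lam; split.
- by move=> k km; rewrite !sgE// ?ltnS// ltnW.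
- by rewrite /lam; case: (e); rewrite ?expr0 ?expr1; lra.
apply/matrixP => i j; rewrite (ord1 j) {j}.
(* Coordinate [i] of [xi (t - s)] as a polynomial in [s], of degree [m - i]. *)
pose q : {poly R} := ((m - i)`!%:R^-1) *: (t%:P - 'X) ^+ (m - i).
have qE s : q.[s] = xi m (t - s) i 0.
  by rewrite /q hornerZ horner_exp !hornerE mxE mulrC.
have sq : (size q <= m.+1)%N.
  apply: leq_trans (size_scale_leq _ _) _.
  rewrite -opprB -scaleN1r exprZn; apply: leq_trans (size_scale_leq _ _) _.
  by rewrite size_exp_XsubC ltnS leq_subr.
have cq : continuous (horner q) by exact: continuous_horner.
rewrite (integrator_trajectory t0 cu cx dx) x0E.
(* On [[0, t]] the input splits as [nu + W]; the first part belongs to [x_mid], the second is a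
   moment of [W]. *)
have E1 : integ 0 t (fun s => u s * xi m (t - s) i 0) =
    integ 0 t (fun s => nu A b vmin vmax z0 s * xi m (t - s) i 0) +
    integ 0 t (fun s => q.[s] * W s).
  rewrite (@eq_integ _ (fun s => nu A b vmin vmax z0 s * xi m (t - s) i 0)
    (fun s => q.[s] * NU s)); last first.
    by move=> s st; rewrite qE /NU /= clamp_id// mulrC.
  rewrite -integD; last 2 first.
  - by move=> s; apply: cvgM; [exact: cq|exact: cNU].
  - by move=> s; apply: cvgM; [exact: cq|exact: cW].
  apply: eq_integ => s st; rewrite qE /W /U /= [clamp 0 t s]clamp_id//; ring.
have E2 : x_alt A b vmin vmax z0 t sigma i 0 =
    \sum_(k < m.+1) (-1) ^+ k *
          integ (nth t (0 :: r) k) (nth t r k) (fun s => q.[s] * MU s).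
  rewrite mxE; apply: eq_bigr => k _; congr (_ * _).
  rewrite !sgE ?(ltnW (ltn_ord k))//; apply: eq_integ => s /andP[s1 s2].
  rewrite qE /MU /= clamp_id 1?mulrC//.
  have /andP[h1 _] := sg_itv k; have /andP[_ h2] := sg_itv k.+1.
  by rewrite (le_trans h1 s1) (le_trans s2 h2).
rewrite E1 HK// -E2 !mxE /lam.
by field.
Qed.
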